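(* Let $r,s$ be positive integers with $r>s$, and for each $i\in\{1,\ldots,r\}$ let $G_i$ be a graph with $n_i$ vertices and $m_i$ edges. Let $m=\min\{m_1,\ldots,m_r\}$, $n=\min\{n_1,\ldots,n_r\}$ and $n'=\max\{n_1,\ldots,n_r\}$. Then $$\mathrm{R}_{r,s}(G_1,\ldots,G_r)\geq \frac{n^{n/n'}}{e}\left(\left(\frac{r}{s}\right)^{m}\frac{(2m)^{m}}{\sum_{i=1}^{r}(e n_i^{2})^{m_i}}\right)^{1/n'}.$$
   Context: For positive integers $r\ge s$ and graphs $G_1,\dots,G_r$, the set-coloring Ramsey number $\mathrm{R}_{r,s}(G_1,\dots,G_r)$ is the least $N\in\mathbb{N}$ such that for every coloring $\chi:E(K_N)\to\binom{[r]}{s}$ (each edge receives a set of $s$ distinct colors from $[r]$) there exist $i\in[r]$ and a copy of $G_i$ in $K_N$ with $i\in\chi(e)$ for every edge $e$ of this copy. *)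

(* Defs.v *)
From mathcomp Require Import all_boot boolp.
Set Implicit Arguments.
Unset Strict Implicit.
Unset Printing Implicit Defensive.

Record sgraph := SGraph {
  vertex :> finType;
  adj : rel vertex;
  adj_sym : symmetric adj;
  adj_irrefl : irreflexive adj
}.

Definition edges (G : sgraph) : {set {set G}} :=
  [set [set p.1; p.2] | p in [set p : G * G | adj p.1 p.2]].

Section Complete.
Variable N : nat.

Definition complete_adj : rel 'I_N := fun x y => x != y.

Lemma complete_adj_sym : symmetric complete_adj.
Proof. by move=> x y; rewrite /complete_adj eq_sym. Qed.

Lemma complete_adj_irrefl : irreflexive complete_adj.
Proof. by move=> x; rewrite /complete_adj eqxx. Qed.

Definition complete : sgraph := SGraph complete_adj_sym complete_adj_irrefl.
End Complete.

(* An embedding f of G in H determines the copy of G in H whose edges are the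
   sets f @: e with e an edge of G, and every copy arises in this way. *)
Definition embedding (G H : sgraph) (f : G -> H) : Prop :=
  injective f /\ forall x y : G, adj x y -> adj (f x) (f y).

(* Only the values of chi on the edges of the complete graph matter. *)
Definition set_coloring (r s N : nat)
    (chi : {set complete N} -> {set 'I_r}) : Prop :=
  forall e, e \in edges (complete N) -> #|chi e| = s.

Definition set_arrows (r s : nat) (G : 'I_r -> sgraph) (N : nat) : Prop :=
  forall chi : {set complete N} -> {set 'I_r}, set_coloring s chi ->
  exists (i : 'I_r) (f : G i -> complete N),
    embedding f /\ forall e, e \in edges (G i) -> i \in chi (f @: e).

Fixpoint greedy_size (r l : nat) : nat :=
  if l is l'.+1 then (r * greedy_size r l').+1 else 0.

Lemma greedy_seq (T C : finType) (c : T -> T -> C) (l : nat) (A : {set T}) :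
  greedy_size #|C| l <= #|A| ->
  exists s : seq (T * C), [/\ size s = l, all (fun p => p.1 \in A) s
    & pairwise (fun p q => (p.1 != q.1) && (c p.1 q.1 == p.2)) s].
Proof.
elim: l A => [|l IHl] A /= leA; first by exists [::].
have /card_gt0P[x xA] : 0 < #|A| by apply: leq_trans leA.
pose B i := [set y in A :\ x | c x y == i].
have [i leB] : exists i, greedy_size #|C| l <= #|B i|.
  apply: contrapT => /forallNP ltB.
  have ltBb i : #|B i| < greedy_size #|C| l by rewrite ltnNge; apply/negP.
  have cardA : #|A :\ x| = \sum_i #|B i|.
    rewrite -sum1_card (partition_big (c x) xpredT) //=.
    by apply: eq_bigr => i _; rewrite sum1dep_card.
  move: leA; rewrite (cardsD1 x) xA add1n ltnS cardA => leA.
  have le2 : \sum_i (#|B i|).+1 <= #|C| * greedy_size #|C| l.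
    by rewrite -sum_nat_const; apply: leq_sum.
  have /card_gt0P[y yA] : 0 < #|C|.
    by apply/card_gt0P; exists (c x x).
  move: (leq_trans le2 leA); rewrite leqNgt => /negP; apply.
  by rewrite [ltnRHS](bigD1 y) // [ltnLHS](bigD1 y) //= addSn ltnS leq_add2l leq_sum.
have [s [sz sB ps]] := IHl _ leB.
exists ((x, i) :: s); split => /=; first by rewrite sz.
  rewrite xA /=; apply: sub_all sB => p; rewrite !inE.
  by case/andP => /andP[].
rewrite ps andbT; apply: sub_all sB => p; rewrite !inE eq_sym.
by case/andP => /andP[-> _].
Qed.

Lemma set_arrows_exists (r s : nat) (G : 'I_r -> sgraph) :
  0 < s -> exists N, `[< set_arrows s G N >].
Proof.
move=> s_gt0; case: (posnP r) => [r0|r_gt0].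
  exists 2; apply/asboolP => chi /(_ [set ord0; ord_max]) chiP.
  have : #|chi [set ord0; ord_max]| = s.
    by apply: chiP; apply/imsetP; exists (ord0, ord_max); rewrite ?inE.
  move=> es; have : s <= 0.
    by rewrite -r0 -es; apply: leq_trans (max_card _) _; rewrite card_ord.
  by rewrite leqNgt s_gt0.
pose i0 := Ordinal r_gt0.
pose k := (\max_i #|G i|).+1.
pose N := greedy_size r (r * k).
exists N; apply/asboolP => chi chiP.
pose c (x y : 'I_N) := odflt i0 [pick i in chi [set x; y]].
have c_sym x y : c x y = c y x by rewrite /c setUC.
have cP x y : x != y -> c x y \in chi [set x; y].
  move=> xy; rewrite /c; case: pickP => //= chi0.
  move: s_gt0; rewrite -(chiP [set x; y]).
    by rewrite (eq_card0 chi0).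
  by apply/imsetP; exists (x, y); rewrite ?inE.
have [|t [sz _ pt]] := @greedy_seq _ _ c (r * k) [set: 'I_N].
  by rewrite cardsT !card_ord.
have [i lei] : exists i, k <= count (fun p => p.2 == i) t.
  apply: contrapT => /forallNP ltB.
  have ltBb i : count (fun p : 'I_N * 'I_r => p.2 == i) t < k.
    by rewrite ltnNge; apply/negP.
  have szt : size t = \sum_i count (fun p : 'I_N * 'I_r => p.2 == i) t.
    rewrite -sum1_size (partition_big snd xpredT) //=.
    by apply: eq_bigr => i _; rewrite sum1_count.
  have : \sum_(i < r) count (fun p : 'I_N * 'I_r => p.2 == i) t <= r * k.-1.
    have -> : r * k.-1 = \sum_(i < r) k.-1 by rewrite sum_nat_const card_ord.
    by apply: leq_sum => i _; rewrite -ltnS; apply: ltBb.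
  by rewrite -szt sz leq_pmul2l // /k /= ltnn.
pose u := [seq p <- t | p.2 == i].
have szu : k <= size u by rewrite size_filter.
have pu : pairwise (fun p q : 'I_N * 'I_r => (p.1 != q.1) && (c p.1 q.1 == i)) u.
  have : pairwise (fun p q => (p.1 != q.1) && (c p.1 q.1 == p.2)) u.
    exact: subseq_pairwise (filter_subseq _ _) pt.
  apply: (@sub_in_pairwise _ [pred p | p.2 == i]).
    by move=> p q /eqP /= -> _.
  by apply/allP => p; rewrite mem_filter => /andP[].
have [p0 _] : exists p0 : 'I_N * 'I_r, true.
  by case: (u) szu => // p ? _; exists p.
pose f (x : G i) : 'I_N := (nth p0 u (enum_rank x)).1.
have ltu (x : G i) : enum_rank x < size u.
  apply: leq_trans (ltn_ord _) (leq_trans _ szu).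
  by apply: leqW; apply: (leq_bigmax i).
have fP (x y : G i) : x != y -> (f x != f y) && (c (f x) (f y) == i).
  move=> xy; have H a b := pairwiseP p0 pu a b.
  have : enum_rank x != enum_rank y by rewrite (inj_eq enum_rank_inj).
  rewrite -val_eqE neq_ltn => /orP[] lt.
    by apply: H => //; rewrite inE.
  by rewrite eq_sym c_sym; apply: H => //; rewrite inE.
exists i, f; split.
  split=> [x y fxy|x y xy].
    by apply/eqP; apply: contraT => /fP; rewrite fxy eqxx.
  have /fP/andP[//] : x != y.
  by apply: contraL xy => /eqP ->; rewrite adj_irrefl.
move=> e /imsetP[[x y]]; rewrite inE /= => xy ->.
have /fP/andP[fxy /eqP cfi] : x != y.
  by apply: contraL xy => /eqP ->; rewrite adj_irrefl.
by have := cP _ _ fxy; rewrite cfi imsetU1 imset_set1.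
Qed.

(* R_{r,s}(G_1, ..., G_r); the proof of 0 < s is only used to know that some N
   is admissible, and the value does not depend on it. *)
Definition set_ramsey (r s : nat) (s_gt0 : 0 < s) (G : 'I_r -> sgraph) : nat :=
  ex_minn (set_arrows_exists G s_gt0).

(* The default value \max_i F i does not affect the minimum when 0 < r. *)
Definition min_ord (r : nat) (F : 'I_r -> nat) : nat :=
  \big[minn/(\max_(i < r) F i)]_(i < r) F i.

Lemma min_ord_le (r : nat) (F : 'I_r -> nat) (i : 'I_r) : min_ord F <= F i.
Proof.
rewrite /min_ord; move: (\max_(j < r) F j) => d.
have : i \in index_enum 'I_r by rewrite mem_index_enum.
elim: (index_enum _) => // j e IHe; rewrite inE big_cons => /predU1P[<-|/IHe].
  exact: geq_minl.
by apply: leq_trans; apply: geq_minr.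
Qed.

Lemma min_ord_attained (r : nat) (F : 'I_r -> nat) :
  0 < r -> exists i : 'I_r, F i = min_ord F.
Proof.
move=> r_gt0; rewrite /min_ord.
apply: (big_ind (fun k => exists i, F i = k)).
- have [|i ->] := @eq_bigmax _ F; first by rewrite card_ord.
  by exists i.
- move=> _ _ [i <-] [j <-].
  by case: (leqP (F i) (F j)) => _; [exists i|exists j].
- by move=> i _; exists i.
Qed.

(* Main.v *)
(** Give each edge of K_N a uniformly random s-subset of the r colors. A fixed
set of m_i edges lies in color i with probability (s/r)^m_i, and a copy of G_i
is a set of m_i pairs inside a set of n_i vertices. If N is the Ramsey number,
every coloring contains a copy, so the union bound gives
1 <= sum_i C(N, n_i) C(C(n_i, 2), m_i) (s/r)^m_i,
and C(a, k) <= (e a / k)^k turns this into the claim. *)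
Require Import Defs.
From mathcomp Require Import all_boot all_order all_algebra.
From mathcomp Require Import reals sequences exp.
Import Order.TTheory GRing.Theory Num.Theory.
Local Open Scope ring_scope.

Lemma card_bigcup_le (I T : finType) (P : pred I) (F : I -> {set T}) :
  (#|\bigcup_(i | P i) F i| <= \sum_(i | P i) #|F i|)%N.
Proof.
elim/big_rec2: _ => [|i n A _ leAn]; first by rewrite cards0.
by rewrite (leq_trans (leq_card_setU _ _)) // leq_add2l.
Qed.

(** Deleting [x] is a bijection onto the [k]-subsets of the complement of [x]. *)
Lemma card_draws_mem (T : finType) (x : T) (k : nat) :
  #|[set A : {set T} | (x \in A) && (#|A| == k.+1)]| = 'C(#|T|.-1, k).
Proof.
have subC1 (A : {set T}) : (A \subset [set~ x]) = (x \notin A).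
  by rewrite -disjoints_subset disjoint_sym disjoints1.
have <- : #|[set~ x]| = #|T|.-1 by rewrite cardsC1.
rewrite -cards_draws -[RHS](card_in_imset (f := fun A => x |: A)); last first.
  move=> A B; rewrite !inE !subC1 => /andP[xA _] /andP[xB _] eqAB.
  by rewrite -(setU1K xA) eqAB setU1K.
apply/eq_card => A; rewrite !inE; apply/andP/imsetP => [[xA /eqP cardA]|[B]].
  exists (A :\ x); last by rewrite setD1K.
  rewrite inE subC1 !inE eqxx /=.
  by move: cardA; rewrite (cardsD1 x) xA => -[<-].
rewrite inE subC1 => /andP[xB /eqP cardB] ->.
by rewrite setU11 cardsU1 xB cardB.
Qed.

(** The probability (s/r)^|E| that every element of [E] receives color [x], with denominators
    cleared to stay in [nat]. The count is a product over [e]: each [e] in [E] contributes C(r-1,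
    s-1), and r C(r-1, s-1) = s C(r, s). *)
Lemma card_colorings_mem (U T : finType) (x : T) (s : nat) (E : {set U}) :
  (0 < s)%N ->
  (#|T| ^ #|E| * #|family (fun e : U =>
      mem [set A : {set T} | ((e \in E) ==> (x \in A)) && (#|A| == s)])| =
   s ^ #|E| * 'C(#|T|, s) ^ #|U|)%N.
Proof.
case: s => // s _; rewrite card_family foldrE big_map big_enum /=.
have expE k : (k ^ #|E| = \prod_(e : U) if e \in E then k else 1)%N.
  by rewrite -big_mkcond /= prod_nat_const.
have -> : ('C(#|T|, s.+1) ^ #|U| = \prod_(e : U) 'C(#|T|, s.+1))%N.
  by rewrite prod_nat_const.
rewrite !expE -!big_split /=; apply: eq_bigr => e _.
case: (e \in E) => /=; last by rewrite !mul1n -card_draws; apply: eq_card => A; rewrite !inE.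
have T_gt0 : (0 < #|T|)%N by apply/card_gt0P; exists x.
rewrite -[in RHS](prednK T_gt0) -mul_bin_diag (prednK T_gt0) -(card_draws_mem _ x).
by congr (_ * _)%N.
Qed.

(** This records that a copy is a set of m_i pairs inside a set of n_i vertices, which is all that
    the union bound retains of it. *)
Lemma edges_embedding (G : sgraph) (N : nat) (f : G -> complete N) :
  embedding f ->
  [/\ #|f @: [set: G]| = #|G|,
      #|[set f @: e | e : {set G} in edges G]| = #|edges G| &
      [set f @: e | e : {set G} in edges G] \subset
        [set e : {set complete N} | (e \subset f @: [set: G]) && (#|e| == 2)]].
Proof.
move=> [f_inj f_adj]; split.
- by rewrite card_imset // cardsT.
- by rewrite card_imset //; apply: imset_inj.
apply/subsetP => e /imsetP[e0 /imsetP[[x y]]]; rewrite inE /= => xy -> ->.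
by rewrite inE imsetS ?subsetT //= imsetU1 imset_set1 cards2 (f_adj _ _ xy : f x != f y).
Qed.

Lemma set_arrows_union_bound (R : realType) (r s N : nat)
    (G : 'I_r -> sgraph) : (0 < s <= r)%N -> set_arrows s G N ->
  1 <= \sum_(i < r) 'C(N, #|G i|)%:R *
         ('C('C(#|G i|, 2), #|edges (G i)|)%:R *
           (s%:R / r%:R) ^+ #|edges (G i)|) :> R.
Proof.
move=> /andP[s_gt0 s_le_r] arrN; have r_gt0 := leq_trans s_gt0 s_le_r.
pose U := {set complete N}.
(* Every subset of the vertex set gets a color set here, not only the edges. The surplus factors
   occur equally in [total], so the ratio is still (s/r)^|E|. *)
pose col (i : 'I_r) (E : {set U}) := family (fun e : U =>
  mem [set A : {set 'I_r} | ((e \in E) ==> (i \in A)) && (#|A| == s)]).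
pose pairs (V : U) := [set e : U | (e \subset V) && (#|e| == 2)].
pose draws (i : 'I_r) (V : U) := [set E : {set U} |
  (E \subset pairs V) && (#|E| == #|edges (G i)|)].
pose total := ('C(r, s) ^ #|U|)%N.
have total_gt0 : 0 < total%:R :> R by rewrite ltr0n expn_gt0 bin_gt0 s_le_r.
have col_card i E :
    #|col i E|%:R = (s%:R / r%:R) ^+ #|E| * total%:R :> R.
  have := @card_colorings_mem U 'I_r i s E s_gt0.
  rewrite -/(col i E) card_ord -/total => /(congr1 (fun k => k%:R : R)).
  rewrite !natrM !natrX => eqc; rewrite expr_div_n mulrAC -eqc mulrAC divff ?mul1r //.
  by rewrite expf_neq0 // pnatr_eq0 -lt0n.
(* By [arrN], each coloring lies in some [col i E], with [V] the vertex set and [E] the edge set of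
   a monochromatic copy. *)
have cover : (total <= \sum_i \sum_(V : U | #|V| == #|G i|)
    \sum_(E in draws i V) #|col i E|)%N.
  have -> : total = #|family (fun _ : U => mem [set A : {set 'I_r} | #|A| == s])|.
    rewrite card_family foldrE big_map big_enum /= prod_nat_const.
    by rewrite card_draws card_ord.
  apply: leq_trans (_ : #|\bigcup_i \bigcup_(V : U | #|V| == #|G i|)
    \bigcup_(E in draws i V) [set chi in col i E]| <= _)%N.
    apply/subset_leq_card/subsetP => chi /familyP chiP.
    have [|i [f [f_emb f_col]]] := arrN chi.
      by move=> e _; have := chiP e; rewrite inE => /eqP.
    have [cardV cardE subE] := @edges_embedding _ _ _ f_emb.
    apply/bigcupP; exists i => //; apply/bigcupP.
    exists (f @: [set: G i]); first by rewrite cardV.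
    apply/bigcupP; exists [set f @: e | e : {set G i} in edges (G i)].
      by rewrite inE subE cardE eqxx.
    rewrite inE; apply/familyP => e; have := chiP e; rewrite !inE => ->.
    by rewrite andbT; apply/implyP => /imsetP[e' e'G ->]; apply: f_col.
  apply: leq_trans (card_bigcup_le _ _ _ _) _; apply: leq_sum => i _.
  apply: leq_trans (card_bigcup_le _ _ _ _) _; apply: leq_sum => V _.
  apply: leq_trans (card_bigcup_le _ _ _ _) _; apply: leq_sum => E _.
  by rewrite cardsE.
rewrite -(ler_pM2r total_gt0) mul1r.
apply: le_trans (_ : (\sum_i \sum_(V : U | #|V| == #|G i|)
    \sum_(E in draws i V) #|col i E|)%:R <= _); first by rewrite ler_nat.
rewrite natr_sum mulr_suml le_eqVlt; apply/orP; left; apply/eqP.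
apply: eq_bigr => i _; rewrite natr_sum.
(* The summands depend only on the sizes of [V] and [E], so both sums become binomial
   coefficients. *)
transitivity (\sum_(V : U | #|V| == #|G i|) ('C('C(#|G i|, 2), #|edges (G i)|)%:R *
           (s%:R / r%:R) ^+ #|edges (G i)|) * total%:R : R).
  apply: eq_bigr => V /eqP cardV; rewrite natr_sum.
  rewrite -cardV -!cards_draws -/(pairs V) -/(draws i V).
  rewrite -mulrA mulr_natl -sumr_const; apply: eq_bigr => E.
  by rewrite inE col_card => /andP[_ /eqP ->].
rewrite -mulr_suml; congr (_ * _); rewrite sumr_const.
rewrite -[LHS]mulr_natl; congr (_%:R * _).
rewrite -[in RHS](card_ord N) -card_draws.
by apply: eq_card => V; rewrite !inE.
Qed.

(** Combines C(a, k) k! <= a^k with k^k <= e^k k!, the latter from a single term of the series of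
    e^k. The product form also covers k = 0, where 0^0 = 1. *)
Lemma bin_mul_exp_le (R : realType) (a k : nat) :
  'C(a, k)%:R * k%:R ^+ k <= (expR 1 * a%:R) ^+ k :> R.
Proof.
have kfact_gt0 : 0 < k`!%:R :> R by rewrite ltr0n fact_gt0.
have exp_fact : k%:R ^+ k <= expR 1 ^+ k * k`!%:R :> R.
  rewrite -ler_pdivrMr // -expRM_natl mulr1.
  case: k {kfact_gt0} => [|k]; first by rewrite expR0 fact0 divr1 expr0.
  apply: le_trans (expR_ge1Dxn k (ler0n _ _)).
  by rewrite lerDr.
have bin_fact : 'C(a, k)%:R * k`!%:R <= a%:R ^+ k :> R.
  rewrite -natrM bin_ffact -natrX ler_nat ffact_prod.
  rewrite -[in leqRHS](card_ord k) -prod_nat_const.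
  by apply: leq_prod => i _; apply: leq_subr.
apply: le_trans (ler_wpM2l (ler0n _ _) exp_fact) _.
by rewrite mulrCA exprMn ler_wpM2l // exprn_ge0 // expR_ge0.
Qed.

Lemma leq_self_exp (a b : nat) : (a <= b -> a ^ a <= b ^ b)%N.
Proof.
case: a => [|a] ab; first by rewrite expn0; case: b ab => // b _; apply: expn_gt0.
by rewrite (leq_trans (n := b ^ a.+1)) ?leq_exp2r // leq_pexp2l // (leq_trans _ ab).
Qed.

(** Serves, with c = 2r/s, to replace each m_i by the minimum m. *)
Lemma ler_mul_self_exp (R : realType) (c : R) (a b : nat) :
  1 <= c -> (a <= b)%N -> (c * a%:R) ^+ a <= (c * b%:R) ^+ b.
Proof.
move=> c1 ab; rewrite !exprMn -!natrX; apply: ler_pM; rewrite ?ler0n //.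
- by rewrite exprn_ge0 // (le_trans ler01).
- exact: ler_weXn2l.
by rewrite ler_nat leq_self_exp.
Qed.

(** The factor 2^m is absorbed by 2 C(k, 2) = k (k-1) <= k^2. *)
Lemma bin_bin2_mul_exp_le (R : realType) (k m : nat) :
  'C('C(k, 2), m)%:R * (2 * m%:R) ^+ m <= (expR 1 * k%:R ^+ 2) ^+ m :> R.
Proof.
rewrite exprMn mulrCA.
apply: le_trans (ler_wpM2l _ (bin_mul_exp_le R 'C(k, 2) m)) _.
  by rewrite exprn_ge0.
rewrite -exprMn mulrCA; apply: lerXn2r; rewrite ?nnegrE ?mulr_ge0 ?expR_ge0 //.
rewrite ler_wpM2l ?expR_ge0 // -natrM -natrX ler_nat.
rewrite mulnC bin2 -divn2 (leq_trans (leq_trunc_div _ _)) //.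
by rewrite leq_mul2l leq_pred orbT.
Qed.

Theorem theorem3p6 (R : realType) (r s : nat) (s_gt0 : (0 < s)%N)
    (s_lt_r : (s < r)%N) (G : 'I_r -> sgraph)
    (G_nonempty : forall i : 'I_r, (0 < #|G i|)%N) :
  let nv (i : 'I_r) := #|G i| in
  let ne (i : 'I_r) := #|edges (G i)| in
  let m := min_ord ne in
  let n := min_ord nv in
  let n' := (\max_(i < r) nv i)%N in
  (n%:R `^ (n%:R / n'%:R)) / expR 1 *
    ((r%:R / s%:R) ^+ m * ((2 * m%:R) ^+ m /
       \sum_(i < r) (expR 1 * (nv i)%:R ^+ 2) ^+ ne i)) `^ (n'%:R^-1)
  <= (set_ramsey s_gt0 G)%:R :> R.
Proof.
cbv beta zeta; pose nv i := #|G i|; pose ne i := #|edges (G i)|.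
set m := min_ord ne; set n := min_ord nv; set n' := (\max_(i < r) nv i)%N.
set S : R := \sum_(i < r) _.
rewrite /set_ramsey; case: ex_minnP => N /boolp.asboolP arrN _.
have r_gt0 : (0 < r)%N by apply: leq_ltn_trans s_lt_r.
pose i0 := Ordinal r_gt0.
have e_ge0 : 0 <= expR 1 :> R := expR_ge0 1.
have n'_gt0 : (0 < n')%N by apply: leq_trans (G_nonempty i0) (leq_bigmax i0).
(* Some copy exists, as the constant coloring by the first [s] colors shows, and it has a vertex.
   Hence eN >= 1, so exponents of eN may be raised from n_i to n'. *)
have N_gt0 : (0 < N)%N.
  have [|i [f _]] := arrN (fun _ => [set i : 'I_r | (i < s)%N]).
    move=> e _; rewrite -[RHS]card_ord -(card_imset (f := widen_ord (ltnW s_lt_r))); last first.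
      by move=> a b /(congr1 val) ab; apply: val_inj.
    apply: eq_card => i; rewrite inE; apply/idP/imsetP => [lt_is|[j _ ->]] //=.
    by exists (Ordinal lt_is) => //; apply: val_inj.
  have /card_gt0P[x _] := G_nonempty i.
  by apply: leq_ltn_trans (ltn_ord (f x)).
have eN_ge1 : 1 <= expR 1 * N%:R :> R.
  by rewrite -[leLHS]mulr1 ler_pM ?ler1n // (le_trans _ (expR_ge1Dx 1)) ?lerDl.
have rs_ge1 : 1 <= r%:R / s%:R :> R.
  by rewrite ler_pdivlMr ?ltr0n // mul1r ler_nat ltnW.
have rs_ge0 := le_trans ler01 rs_ge1.
have term_gt0 i : 0 < (expR 1 * (nv i)%:R ^+ 2) ^+ ne i :> R.
  by rewrite exprn_gt0 // mulr_gt0 ?expR_gt0 // exprn_gt0 // ltr0n G_nonempty.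
have S_gt0 : 0 < S.
  rewrite /S (bigD1 i0) //=; apply: ltr_pwDl; first exact: term_gt0.
  by apply: sumr_ge0 => i _; apply/ltW/term_gt0.
pose B : R := (r%:R / s%:R) ^+ m * (2 * m%:R) ^+ m.
have B_ge0 : 0 <= B by rewrite mulr_ge0 // exprn_ge0 // mulr_ge0.
(* The claim raised to the power n', with denominators cleared; it follows by comparing the union
   bound, multiplied by n^n B, with [S] term by term. *)
have main : n%:R ^+ n * B <= (expR 1 * N%:R) ^+ n' * S.
  have union := set_arrows_union_bound R _ _ _ _ (introT andP (conj s_gt0 (ltnW s_lt_r))) arrN.
  rewrite -[leLHS]mulr1; apply: le_trans (ler_wpM2l _ union) _.
    by rewrite mulr_ge0 // exprn_ge0.
  rewrite mulr_sumr /S mulr_sumr; apply: ler_sum => i _.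
  rewrite -/(nv i) -/(ne i).
  (* n^n <= n_i^n_i, and n_i^n_i C(N, n_i) <= (eN)^n_i <= (eN)^n'. *)
  have vertex_bound : n%:R ^+ n * 'C(N, nv i)%:R <= (expR 1 * N%:R) ^+ n' :> R.
    apply: le_trans (ler_weXn2l eN_ge1 (leq_bigmax i)).
    apply: le_trans (bin_mul_exp_le R N (nv i)).
    by rewrite mulrC ler_wpM2l // -!natrX ler_nat leq_self_exp // min_ord_le.
  (* B = (2mr/s)^m <= (2 m_i r/s)^m_i, whose factor (r/s)^m_i cancels the probability. *)
  have edge_bound : B * ('C('C(nv i, 2), ne i)%:R * (s%:R / r%:R) ^+ ne i) <=
      (expR 1 * (nv i)%:R ^+ 2) ^+ ne i.
    apply: le_trans (bin_bin2_mul_exp_le R (nv i) (ne i)).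
    rewrite mulrCA ler_wpM2l // -invf_div exprVn.
    rewrite ler_pdivrMr ?exprn_gt0 ?(lt_le_trans ltr01) //.
    rewrite /B [leRHS]mulrC -!exprMn !(mulrA _ 2) ler_mul_self_exp ?min_ord_le //.
    by rewrite (le_trans rs_ge1) // ler_peMr // ler1n.
  by rewrite mulrACA ler_pM ?mulr_ge0 ?exprn_ge0 ?divr_ge0 ?mulr_ge0.
(* Both sides are brought to the form of an n'-th root, so that monotonicity of the root reduces the
   claim to [main]. *)
rewrite mulrA -/B powRrM powR_mulrn // mulrAC -powRM ?exprn_ge0 ?(divr_ge0 B_ge0 (ltW S_gt0)) //.
rewrite ler_pdivrMr ?expR_gt0 // [leRHS]mulrC.
have -> : expR 1 * N%:R = ((expR 1 * N%:R) ^+ n') `^ n'%:R^-1 :> R.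
  rewrite -powR_mulrn ?mulr_ge0 // -powRrM divff ?powRr1 ?mulr_ge0 //.
  by rewrite pnatr_eq0 -lt0n.
apply: ge0_ler_powR; rewrite ?nnegrE ?invr_ge0 ?ler0n ?(exprn_ge0 n' (le_trans ler01 eN_ge1)) //.
  by rewrite mulr_ge0 ?exprn_ge0 ?(divr_ge0 B_ge0 (ltW S_gt0)).
by rewrite mulrA ler_pdivrMr.
Qed.
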